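(* Let $(X,p,E)$ be a lattice-normed vector lattice and let $(E,\lVert\cdot\rVert)$ be an order continuous Banach lattice. Let $p\text{-}\lVert x\rVert:=\lVert p(x)\rVert$ for $x\in X$. If $(X,p\text{-}\lVert\cdot\rVert)$ is a $un$-complete Banach lattice, then $X$ is $up$-complete.
   Context: All vector lattices are real and Archimedean. A net $(x_\alpha)$ in a vector lattice is order convergent to $x$ ($x_\alpha\xrightarrow{o}x$) if there is a net $(y_\beta)$ (possibly with a different index set) with $y_\beta\downarrow 0$ such that for each $\beta$ there is $\alpha_\beta$ with $|x_\alpha-x|\le y_\beta$ for all $\alpha\ge\alpha_\beta$. A lattice-normed vector lattice (LNVL) is a triple $(X,p,E)$, where $X$ and $E$ are vector lattices and $p:X\to E_+$ satisfies: $p(x)=0\Leftrightarrow x=0$; $p(\lambda x)=|\lambda|p(x)$; $p(x+y)\le p(x)+p(y)$; and $|x|\le|y|\Rightarrow p(x)\le p(y)$. A net $x_\alpha$ in $X$ is $up$-convergent to $x$ if $p(|x_\alpha-x|\wedge u)\xrightarrow{o}0$ in $E$ for every $u\in X_+$. A net $x_\alpha$ is $up$-Cauchy if $p(|x_\alpha-x_\beta|\wedge u)\xrightarrow{o}0$ over pairs $(\alpha,\beta)$ for every $u\in X_+$; $X$ is $up$-complete if every $up$-Cauchy net in $X$ is $up$-convergent in $X$. In a normed lattice $(X,\lVert\cdot\rVert)$, $x_\alpha$ is $un$-convergent to $x$ if $\lVert|x_\alpha-x|\wedge u\rVert\to0$ for every $u\in X_+$; $x_\alpha$ is $un$-Cauchy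 if $\lVert|x_\alpha-x_\beta|\wedge u\rVert\to0$ over pairs $(\alpha,\beta)$ for every $u\in X_+$. A Banach lattice is $un$-complete if every $un$-Cauchy net is $un$-convergent. A Banach lattice is order continuous if $x_\alpha\downarrow0$ implies $\lVert x_\alpha\rVert\to0$. *)

(* Defs.v *)
From HB Require Import structures.
From mathcomp Require Import all_boot all_order all_algebra.
From mathcomp Require Import all_classical all_reals all_analysis.
Set Implicit Arguments.
Unset Strict Implicit.
Unset Printing Implicit Defensive.
Import Order.TTheory GRing.Theory Num.Theory.
Import numFieldNormedType.Exports.
Local Open Scope classical_set_scope.
Local Open Scope ring_scope.

(* Real Archimedean vector lattices.  The lattice operations are fields of the
   mixin because HB rejects a new join of Order.Lattice with GRing.Lmodule
   (Num.RealDomain already inherits from Order.Lattice and GRing.Zmodule). *)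
HB.mixin Record isVectorLattice (R : realType) V
    & Num.POrderedZmodule V & GRing.Lmodule R V := {
  vlat_leD : forall z x y : V, x <= y -> x + z <= y + z ;
  vlat_leZ : forall (a : R) (x y : V), 0 <= a -> x <= y -> a *: x <= a *: y ;
  vjoin : V -> V -> V ;
  vmeet : V -> V -> V ;
  vjoin_lub : forall x y z : V, (vjoin x y <= z) = (x <= z) && (y <= z) ;
  vmeet_glb : forall x y z : V, (z <= vmeet x y) = (z <= x) && (z <= y) ;
  vlat_archimedean :
    forall x y : V, 0 <= x -> (forall n : nat, x *+ n <= y) -> x = 0
}.

#[short(type="vectorLatticeType")]
HB.structure Definition VectorLattice (R : realType) :=
  {V of Num.POrderedZmodule V & GRing.Lmodule R V & isVectorLattice R V}.

Definition vabs (R : realType) (V : vectorLatticeType R) (x : V) : V :=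
  vjoin x (- x).

Lemma vabs_ge0_id (R : realType) (V : vectorLatticeType R) (x : V) :
  0 <= x -> vabs x = x.
Proof.
move=> x0; apply/le_anti; rewrite /vabs vjoin_lub lexx /=.
have xN : - x <= x.
  apply: (le_trans _ x0); have := vlat_leD (- x) _ _ x0.
  by rewrite add0r subrr.
rewrite xN /=.
by have := lexx (vjoin x (- x)); rewrite vjoin_lub => /andP[].
Qed.

HB.mixin Record isDirected (d : Order.disp_t) I & Order.Preorder d I := {
  directed_inhabited : inhabited I ;
  directed_ub : forall i j : I, exists k : I, (i <= k)%O && (j <= k)%O
}.

#[short(type="directedType")]
HB.structure Definition Directed (d : Order.disp_t) :=
  {I of Order.Preorder d I & isDirected d I}.

Section DirectedProd.
Variables (d1 d2 : Order.disp_t) (I : directedType d1) (J : directedType d2).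

Let prod_inhabited : inhabited (I *p J).
Proof.
by have [i] := @directed_inhabited _ I; have [j] := @directed_inhabited _ J;
   exists; exact: (i, j).
Qed.

Let prod_ub (a b : I *p J) : exists c : I *p J, (a <= c)%O && (b <= c)%O.
Proof.
case: a b => [a1 a2] [b1 b2].
have [c1 /andP[ac1 bc1]] := directed_ub a1 b1.
have [c2 /andP[ac2 bc2]] := directed_ub a2 b2.
by exists (c1, c2); rewrite !Order.ProdOrder.leEprod /= ac1 ac2 bc1 bc2.
Qed.

HB.instance Definition _ :=
  isDirected.Build (Order.prod_display d1 d2)
    (I *prod[Order.prod_display d1 d2] J)
    prod_inhabited prod_ub.
End DirectedProd.

Definition tails (d : Order.disp_t) (I : directedType d) : set_system I :=
  [set A | exists i : I, forall j : I, (i <= j)%O -> A j].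
Arguments tails {d} I.

Definition decreases_to0 (R : realType) (V : vectorLatticeType R)
    (d : Order.disp_t) (I : directedType d) (y : I -> V) : Prop :=
  (forall i j : I, (i <= j)%O -> y j <= y i) /\ infimums (range y) 0.

Definition o_cvg (R : realType) (V : vectorLatticeType R)
    (d : Order.disp_t) (I : directedType d) (x : I -> V) (l : V) : Prop :=
  exists (d' : Order.disp_t) (J : directedType d') (y : J -> V),
    decreases_to0 y /\
    forall b : J, \forall a \near tails I, vabs (x a - l) <= y b.

Record latticeNorm (R : realType) (V : vectorLatticeType R) := LatticeNorm {
  lnorm :> V -> R ;
  lnorm_eq0 : forall x : V, lnorm x = 0 -> x = 0 ;
  lnormZ : forall (a : R) (x : V), lnorm (a *: x) = `|a| * lnorm x ;
  ler_lnormD : forall x y : V, lnorm (x + y) <= lnorm x + lnorm y ;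
  ler_lnorm : forall x y : V, vabs x <= vabs y -> lnorm x <= lnorm y
}.

(* A copy of V carrying the topology and the uniformity of the norm N. *)
Definition normed_by (R : realType) (V : vectorLatticeType R)
  (N : latticeNorm V) : Type := V.

HB.instance Definition _ (R : realType) (V : vectorLatticeType R)
  (N : latticeNorm V) := GRing.Lmodule.on (normed_by N).
HB.instance Definition _ (R : realType) (V : vectorLatticeType R)
    (N : latticeNorm V) :=
  Lmodule_isNormed.Build R (normed_by N)
    (@ler_lnormD R V N) (@lnormZ R V N) (@lnorm_eq0 R V N).

(* The field of the library's Uniform_isComplete, as a proposition. *)
Definition banach_lattice (R : realType) (V : vectorLatticeType R)
    (N : latticeNorm V) : Prop :=
  forall F : set_system (normed_by N), ProperFilter F -> cauchy F -> cvg F.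

Definition order_continuous (R : realType) (V : vectorLatticeType R)
    (N : latticeNorm V) : Prop :=
  forall (d : Order.disp_t) (I : directedType d) (x : I -> V),
    decreases_to0 x -> N (x a) @[a --> tails I] --> (0 : R).

Definition un_cvg (R : realType) (V : vectorLatticeType R) (N : latticeNorm V)
    (d : Order.disp_t) (I : directedType d) (x : I -> V) (l : V) : Prop :=
  forall u : V, 0 <= u ->
    N (vmeet (vabs (x a - l)) u) @[a --> tails I] --> (0 : R).

Definition un_cauchy (R : realType) (V : vectorLatticeType R)
    (N : latticeNorm V) (d : Order.disp_t) (I : directedType d)
    (x : I -> V) : Prop :=
  forall u : V, 0 <= u ->
    N (vmeet (vabs (x ab.1 - x ab.2)) u) @[ab --> tails (I *p I)%type]
      --> (0 : R).

Definition un_complete (R : realType) (V : vectorLatticeType R)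
    (N : latticeNorm V) : Prop :=
  forall (d : Order.disp_t) (I : directedType d) (x : I -> V),
    un_cauchy N x -> exists l : V, un_cvg N x l.

(* The E-valued norm p of a lattice-normed vector lattice (X, p, E). *)
Record vectorNorm (R : realType) (X E : vectorLatticeType R) := VectorNorm {
  vnorm :> X -> E ;
  vnorm_ge0 : forall x : X, 0 <= vnorm x ;
  vnorm_eq0 : forall x : X, vnorm x = 0 <-> x = 0 ;
  vnormZ : forall (a : R) (x : X), vnorm (a *: x) = `|a| *: vnorm x ;
  ler_vnormD : forall x y : X, vnorm (x + y) <= vnorm x + vnorm y ;
  ler_vnorm : forall x y : X, vabs x <= vabs y -> vnorm x <= vnorm y
}.

Definition up_cvg (R : realType) (X E : vectorLatticeType R)
    (p : vectorNorm X E) (d : Order.disp_t) (I : directedType d)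
    (x : I -> X) (l : X) : Prop :=
  forall u : X, 0 <= u -> o_cvg (fun a : I => p (vmeet (vabs (x a - l)) u)) 0.

Definition up_cauchy (R : realType) (X E : vectorLatticeType R)
    (p : vectorNorm X E) (d : Order.disp_t) (I : directedType d)
    (x : I -> X) : Prop :=
  forall u : X, 0 <= u ->
    o_cvg (fun ab : I *p I => p (vmeet (vabs (x ab.1 - x ab.2)) u)) 0.

Definition up_complete (R : realType) (X E : vectorLatticeType R)
    (p : vectorNorm X E) : Prop :=
  forall (d : Order.disp_t) (I : directedType d) (x : I -> X),
    up_cauchy p x -> exists l : X, up_cvg p x l.

Section PNorm.
Variables (R : realType) (X E : vectorLatticeType R).
Variables (p : vectorNorm X E) (N : latticeNorm E).

Let lnorm_mono (a b : E) : 0 <= a -> a <= b -> N a <= N b.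
Proof.
by move=> a0 ab; apply: ler_lnorm; rewrite !vabs_ge0_id// (le_trans a0).
Qed.

Let pnorm_eq0 (x : X) : N (p x) = 0 -> x = 0.
Proof. by move=> /lnorm_eq0 /vnorm_eq0. Qed.

Let pnormZ (a : R) (x : X) : N (p (a *: x)) = `|a| * N (p x).
Proof. by rewrite vnormZ lnormZ normr_id. Qed.

Let ler_pnormD (x y : X) : N (p (x + y)) <= N (p x) + N (p y).
Proof.
apply: le_trans (ler_lnormD N _ _).
by apply: lnorm_mono; [exact: vnorm_ge0|exact: ler_vnormD].
Qed.

Let ler_pnorm (x y : X) : vabs x <= vabs y -> N (p x) <= N (p y).
Proof.
by move=> xy; apply: lnorm_mono; [exact: vnorm_ge0|exact: ler_vnorm].
Qed.

Definition pnorm : latticeNorm X :=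
  @LatticeNorm R X (fun x => N (p x)) pnorm_eq0 pnormZ ler_pnormD ler_pnorm.
End PNorm.

(* Main.v *)
(** Order continuity of the norm of [E] turns a [up]-Cauchy net [x] into a
    [un]-Cauchy one for the mixed norm, so [x] is [un]-convergent to some [l].
    If [y] dominates [p (|x_a - x_b| /\ u)] for all large [a] and [b], then
    [p (|x_a - l| /\ u) - y <= p (|x_b - l| /\ u)], and the norm of the right
    hand side tends to [0] along [b]. Hence the positive part of the left hand
    side vanishes, i.e., [p (|x_a - l| /\ u) <= y]: the net controlling the
    Cauchy condition also controls the convergence. *)
Require Import Defs.
From mathcomp Require Import all_boot all_order all_algebra.
From mathcomp Require Import all_classical all_reals all_analysis.
Set Implicit Arguments.
Unset Strict Implicit.
Unset Printing Implicit Defensive.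
Import Order.TTheory GRing.Theory Num.Theory.
Import numFieldNormedType.Exports.
Local Open Scope classical_set_scope.
Local Open Scope ring_scope.

Section VectorLatticeTheory.
Context {R : realType} {V : vectorLatticeType R}.
Implicit Types x y z u : V.

Lemma vlat_leB x y z : (x - z <= y) = (x <= y + z).
Proof.
apply/idP/idP => [/(vlat_leD z)|/(vlat_leD (- z))]; first by rewrite subrK.
by rewrite addrK.
Qed.

Lemma vlat_leD2 x y x' y' : x <= x' -> y <= y' -> x + y <= x' + y'.
Proof.
move=> xx' yy'; apply: le_trans (vlat_leD y _ _ xx') _.
by rewrite ![x' + _]addrC; exact: vlat_leD.
Qed.

Lemma le_vjoinl x y : x <= vjoin x y.
Proof. by have := lexx (vjoin x y); rewrite vjoin_lub => /andP[]. Qed.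

Lemma le_vjoinr x y : y <= vjoin x y.
Proof. by have := lexx (vjoin x y); rewrite vjoin_lub => /andP[]. Qed.

Lemma vmeet_lel x y : vmeet x y <= x.
Proof. by have := lexx (vmeet x y); rewrite vmeet_glb => /andP[]. Qed.

Lemma vmeet_ler x y : vmeet x y <= y.
Proof. by have := lexx (vmeet x y); rewrite vmeet_glb => /andP[]. Qed.

(** Both [x] and [- x] lie below [vabs x]; adding the two bounds gives twice the claim, and scaling
    by one half finishes. *)
Lemma vabs_ge0 x : 0 <= vabs x.
Proof.
have : 0 <= vabs x + vabs x.
  by rewrite -(subrr x) vlat_leD2 ?le_vjoinl ?le_vjoinr.
have half0 : 0 <= 2^-1 :> R by rewrite invr_ge0 ler0n.
move=> /(vlat_leZ _ _ _ half0).
by rewrite scaler0 scalerDr -scalerDl -[2^-1]mul1r -splitr scale1r.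
Qed.

Lemma vabsD x y : vabs (x + y) <= vabs x + vabs y.
Proof.
by rewrite {1}/vabs vjoin_lub opprD !vlat_leD2 ?le_vjoinl ?le_vjoinr.
Qed.

(** Moving one summand to the left leaves a single meet on the right, which splits into two bounds.
    Doing this for each summand leaves [vmeet x u] to be bounded by [y + z], by [u + z] and by
    [u + vmeet y u]. *)
Lemma vmeet_subadditive x y z u : 0 <= y -> 0 <= z -> 0 <= u ->
  x <= y + z -> vmeet x u <= vmeet y u + vmeet z u.
Proof.
move=> y0 z0 u0 xyz; rewrite [leRHS]addrC -vlat_leB vmeet_glb !vlat_leB.
apply/andP; split; last first.
  by rewrite -[leLHS]addr0 vlat_leD2 ?vmeet_ler// vmeet_glb y0.
rewrite addrC -vlat_leB vmeet_glb !vlat_leB (le_trans (vmeet_lel _ _))//=.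
by rewrite -[leLHS]addr0 vlat_leD2 ?vmeet_ler.
Qed.

Variable N : latticeNorm V.

Lemma lnorm_ge0 x : 0 <= N x.
Proof. exact: (@normr_ge0 _ (normed_by N)). Qed.

Lemma ler_lnorm_ge0 x y : 0 <= x -> x <= y -> N x <= N y.
Proof.
by move=> x0 xy; apply: ler_lnorm; rewrite !vabs_ge0_id// (le_trans x0).
Qed.

End VectorLatticeTheory.

Section Tails.
Context {d : Order.disp_t} {I : directedType d}.

#[export] Instance tails_proper_filter : ProperFilter (tails I).
Proof.
split; first by move=> [i] /(_ i (lexx i)).
split.
- by have [i] := @directed_inhabited _ I; exists i.
- move=> A B [i Ai] [j Bj]; have [k /andP[ik jk]] := directed_ub i j.
  by exists k => l kl; split; [apply/Ai/(le_trans ik)|apply/Bj/(le_trans jk)].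
- by move=> A B AB [i Ai]; exists i => j /Ai/AB.
Qed.

(** A common upper bound of the two coordinate thresholds serves for both indices. *)
Lemma near_tails_diag (P : I -> I -> Prop) :
  (\forall ab \near tails (I *p I)%type, P ab.1 ab.2) ->
  exists i, forall a b, (i <= a)%O -> (i <= b)%O -> P a b.
Proof.
move=> [[i j] Pij]; have [k /andP[ik jk]] := directed_ub i j.
exists k => a b ka kb; apply: (Pij (a, b)).
by rewrite Order.ProdOrder.leEprod /= (le_trans ik) ?(le_trans jk).
Qed.

End Tails.

Lemma o_cvg0_lnorm_cvg0 (R : realType) (E : vectorLatticeType R)
    (N : latticeNorm E) (d : Order.disp_t) (I : directedType d) (q : I -> E) :
  order_continuous N -> (forall a, 0 <= q a) -> o_cvg q 0 ->
  N (q a) @[a --> tails I] --> (0 : R).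
Proof.
move=> hoc q0 [d' [J [y [y0 qy]]]]; apply/cvgr0Pnorm_lt => e e0.
(* A single [y b] of norm below [e] is enough: [q] is eventually below it, and [N] is monotone on
   positive elements. *)
have /cvgr0Pnorm_lt/(_ e e0)[b /(_ b (lexx b)) Nyb] := hoc _ _ _ y0.
near=> a.
rewrite ger0_norm ?lnorm_ge0//.
apply: le_lt_trans (le_lt_trans (ler_norm _) Nyb).
apply: ler_lnorm_ge0 => //; rewrite -(vabs_ge0_id (q0 a)) -[q a]subr0.
by near: a; exact: qy.
Unshelve. all: by end_near. Qed.

Lemma le_of_near_leD (R : realType) (E : vectorLatticeType R)
    (N : latticeNorm E) (T : Type) (F : set_system T) (FF : ProperFilter F)
    (x y : E) (z : T -> E) :
  N (z b) @[b --> F] --> (0 : R) -> (forall b, 0 <= z b) ->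
  (\forall b \near F, x <= y + z b) -> x <= y.
Proof.
move=> Nz0 z0 xyz; set w := vjoin (x - y) 0.
have : w = 0; last first.
  by move=> w0; have := le_vjoinl (x - y) 0; rewrite -/w w0 vlat_leB add0r.
apply: (@lnorm_eq0 _ _ N); apply/le_anti; rewrite lnorm_ge0 andbT.
rewrite -(cvg_lim (@Rhausdorff R) Nz0); apply: limr_ge.
  by apply/cvg_ex; exists 0.
(* As [z b] is positive and eventually dominates [x - y], it dominates the positive part [w]. *)
near=> b; apply: ler_lnorm_ge0; first exact: le_vjoinr.
rewrite vjoin_lub z0 andbT vlat_leB addrC; near: b; exact: xyz.
Unshelve. all: by end_near. Qed.

Theorem theorem5p5 (R : realType) (X E : vectorLatticeType R)
    (p : vectorNorm X E) (N : latticeNorm E)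
    (hE : banach_lattice N) (hoc : order_continuous N)
    (hX : banach_lattice (pnorm p N)) (hun : un_complete (pnorm p N)) :
  up_complete p.
Proof.
move=> d I x xC.
have [|l xl] := hun _ _ x.
  move=> u u0; apply: o_cvg0_lnorm_cvg0 (xC u u0) => // ab.
  exact: vnorm_ge0.
exists l => u u0; have [d' [J [y [y0 xy]]]] := xC u u0.
exists d', J, y; split=> // j.
have [i yi] := near_tails_diag
  (P := fun a b => vabs (p (vmeet (vabs (x a - x b)) u) - 0) <= y j) (xy j).
exists i => a ia; rewrite subr0 vabs_ge0_id ?vnorm_ge0//.
(* Here [a] stays fixed beyond [i] and only [b] runs along the net. *)
apply: (le_of_near_leD (N := N) _ (F := tails I)
  (z := fun b => p (vmeet (vabs (x b - l)) u))) => [|b|].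
- exact: xl.
- exact: vnorm_ge0.
exists i => b ib; have := yi a b ia ib.
rewrite subr0 vabs_ge0_id ?vnorm_ge0// => yab.
apply: le_trans (vlat_leD _ _ _ yab); apply: le_trans (ler_vnormD p _ _).
apply: ler_vnorm.
have m0 (s : X) : 0 <= vmeet (vabs s) u by rewrite vmeet_glb vabs_ge0.
(* Monotonicity of [p] compares absolute values; both sides are positive, so these drop out. *)
rewrite (vabs_ge0_id (m0 _)) [leRHS]vabs_ge0_id; last first.
  by rewrite -[leLHS](addr0 0) vlat_leD2.
apply: vmeet_subadditive; rewrite ?vabs_ge0//.
by apply: le_trans (vabsD _ _); rewrite subrKA.
Qed.
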